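(* If $r\ge 2$ and $m\ge r+1$, then \[S(r,m)=S(1,m)+\sum_{k=1}^{r-1}\frac{1}{k}\left[S(k,m-1)-B(k,m)\right].\]
   Context: $H_n=\sum_{k=1}^n\frac1k$, $H_n^{(1)}=H_n$, and $H_n^{(r)}=\sum_{k=1}^n H_k^{(r-1)}$ for $r>1$ (hyperharmonic numbers). $S(r,m):=\sum_{n=1}^\infty\frac{H_n^{(r)}}{n^m}$. $(x)_n=x(x+1)\cdots(x+n-1)$ is the Pochhammer symbol, and $B(k,m)$ is the hypergeometric value ${}_{m+1}F_m(1,1,\dots,1,k+1;\,2,2,\dots,2;\,1)$ (with $m$ upper parameters equal to $1$, one upper parameter $k+1$, and $m$ lower parameters equal to $2$), i.e. $B(k,m)=\sum_{n=0}^\infty\frac{(1)_n^m\,(k+1)_n}{(2)_n^m\,n!}=\sum_{n=0}^\infty\frac{(k+1)_n}{n!\,(n+1)^m}=\frac{1}{k!}\sum_{n=1}^\infty\frac{(n)_k}{n^m}$. *)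

(* Defs.v *)
From Stdlib Require Import Reals List Factorial.
From Coquelicot Require Import Coquelicot.
Open Scope R_scope.

(* [sum_n_m f 1 n] is f 1 + ... + f n, and 0 when n = 0. *)
Definition harmonic (n : nat) : R := sum_n_m (fun k : nat => / INR k) 1 n.

(* The order 0 is not used; the value 1/n is the usual convention. *)
Fixpoint hyperharmonic (r n : nat) : R :=
  match r with
  | O => / INR n
  | S r' =>
      match r' with
      | O => harmonic n
      | S _ => sum_n_m (fun k : nat => hyperharmonic r' k) 1 n
      end
  end.

(* Coquelicot series start at index 0, so the term of index n is the
   mathematical term of index n + 1. *)
Definition euler_term (r m n : nat) : R :=
  hyperharmonic r (S n) / INR (S n) ^ m.

Definition euler_sum (r m : nat) : R := Series (euler_term r m).

Fixpoint pochhammer (x : R) (n : nat) : R :=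
  match n with
  | O => 1
  | S n' => pochhammer x n' * (x + INR n')
  end.

Definition pochhammer_prod (l : list R) (n : nat) : R :=
  fold_right Rmult 1 (map (fun a : R => pochhammer a n) l).

Definition hypergeom_coeff (upper lower : list R) (n : nat) : R :=
  pochhammer_prod upper n / (pochhammer_prod lower n * INR (fact n)).

Definition hypergeom (upper lower : list R) (z : R) : R :=
  PSeries (hypergeom_coeff upper lower) z.

Definition B_upper (k m : nat) : list R := repeat 1 m ++ (INR k + 1) :: nil.
Definition B_lower (m : nat) : list R := repeat 2 m.

Definition B (k m : nat) : R := hypergeom (B_upper k m) (B_lower m) 1.

(* Main.v *)
(** Let h_k(n) be the hyperharmonic numbers and (n)_k the Pochhammer symbol.
    A double induction on k and n, using h_k(n) = h_k(n-1) + h_{k-1}(n), gives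
    k h_{k+1}(n) = (n + k) h_k(n) - (n)_k / k!.  Dividing by k n^m and summing
    over n yields S(k+1,m) = S(k,m) + (S(k,m-1) - B(k,m)) / k, which telescopes
    in k.  All the series are dominated by the series of H_n / n^2, whose
    partial sums are bounded by comparison with the differences of
    (H_n + 2) / n. *)

Require Import Defs.
From Stdlib Require Import Reals List Lra Lia Factorial.
From Coquelicot Require Import Coquelicot.
Open Scope R_scope.

(** * Hyperharmonic numbers: recurrence and growth *)

Lemma INR_S_pos (n : nat) : 0 < INR (S n).
Proof. apply lt_0_INR; lia. Qed.

Lemma hyperharmonic_0_r (k : nat) : hyperharmonic (S k) 0 = 0.
Proof.
  destruct k; simpl; unfold harmonic; rewrite sum_n_m_zero by lia; reflexivity.
Qed.

Lemma hyperharmonic_S (k n : nat) :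
  hyperharmonic (S k) (S n) = hyperharmonic (S k) n + hyperharmonic k (S n).
Proof.
  destruct k.
  - change (harmonic (S n) = harmonic n + / INR (S n)).
    unfold harmonic. rewrite sum_n_Sm by lia. reflexivity.
  - change (sum_n_m (fun i => hyperharmonic (S k) i) 1 (S n) =
      sum_n_m (fun i => hyperharmonic (S k) i) 1 n + hyperharmonic (S k) (S n)).
    rewrite sum_n_Sm by lia. reflexivity.
Qed.

Lemma hyperharmonic_ge0 (k n : nat) : 0 <= hyperharmonic k (S n).
Proof.
  revert n; induction k as [|k IHk]; intros n.
  - apply Rlt_le, Rinv_0_lt_compat, INR_S_pos.
  - induction n as [|n IHn]; rewrite hyperharmonic_S.
    + rewrite hyperharmonic_0_r. specialize (IHk 0%nat). lra.
    + specialize (IHk (S n)). lra.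
Qed.

(** A sum of n terms that are nondecreasing in the index is at most n times its last term. *)
Lemma hyperharmonic_le_mul (k n : nat) :
  hyperharmonic (S (S k)) n <= INR n * hyperharmonic (S k) n.
Proof.
  induction n as [|n IHn].
  - rewrite !hyperharmonic_0_r. simpl. lra.
  - rewrite (hyperharmonic_S (S k) n).
    assert (mono : hyperharmonic (S k) n <= hyperharmonic (S k) (S n)).
    { rewrite (hyperharmonic_S k n). pose proof (hyperharmonic_ge0 k n). lra. }
    apply (Rmult_le_compat_l (INR n)) in mono; [|apply pos_INR].
    rewrite S_INR. lra.
Qed.

Lemma hyperharmonic_le (k n : nat) :
  hyperharmonic (S k) n <= INR n ^ k * harmonic n.
Proof.
  induction k as [|k IHk].
  - simpl. lra.
  - eapply Rle_trans; [apply hyperharmonic_le_mul|].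
    cbn [pow]. rewrite Rmult_assoc.
    apply Rmult_le_compat_l; [apply pos_INR | exact IHk].
Qed.

Lemma harmonic_S (n : nat) : harmonic (S n) = harmonic n + / INR (S n).
Proof. exact (hyperharmonic_S 0 n). Qed.

Lemma harmonic_ge1 (n : nat) : 1 <= harmonic (S n).
Proof.
  induction n as [|n IHn].
  - rewrite harmonic_S. unfold harmonic. rewrite sum_n_m_zero by lia.
    unfold zero; simpl. lra.
  - rewrite harmonic_S.
    pose proof (Rinv_0_lt_compat _ (INR_S_pos (S n))). lra.
Qed.

(** * Pochhammer symbols and the recurrence in the order *)

(** The recursive definition peels off the last factor; here the first one is split off. *)
Lemma pochhammer_shift (x : R) (k : nat) :
  pochhammer x (S k) = x * pochhammer (x + 1) k.
Proof.
  induction k as [|k IHk].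
  - simpl. ring.
  - change (pochhammer x (S k) * (x + INR (S k)) =
      x * (pochhammer (x + 1) k * (x + 1 + INR k))).
    rewrite IHk, S_INR. ring.
Qed.

(** Both symbols contain (x+1)_k; the remaining factors x + k + 1 and x differ by k + 1. *)
Lemma pochhammer_diff (x : R) (k : nat) :
  pochhammer (x + 1) (S k) - pochhammer x (S k) =
  INR (S k) * pochhammer (x + 1) k.
Proof.
  rewrite (pochhammer_shift x), S_INR. cbn [pochhammer]. ring.
Qed.

Lemma pochhammer_fact (a b : nat) :
  pochhammer (INR a + 1) b * INR (fact a) = INR (fact (a + b)).
Proof.
  induction b as [|b IHb].
  - rewrite Nat.add_0_r. simpl. ring.
  - rewrite Nat.add_succ_r, fact_simpl, mult_INR, <- IHb, S_INR, plus_INR.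
    cbn [pochhammer]. ring.
Qed.

Lemma pochhammer_pos (x : R) (k : nat) : 0 < x -> 0 < pochhammer x k.
Proof.
  intros hx. induction k as [|k IHk]; simpl; [lra|].
  apply Rmult_lt_0_compat; [exact IHk|].
  pose proof (pos_INR k). lra.
Qed.

(** Factor by factor: x + i <= (i + 1) x for x >= 1. *)
Lemma pochhammer_le (k n : nat) :
  pochhammer (INR (S n)) k <= INR (fact k) * INR (S n) ^ k.
Proof.
  pose proof (INR_S_pos n) as hn.
  induction k as [|k IHk].
  - simpl. lra.
  - replace (INR (fact (S k)) * INR (S n) ^ S k)
      with ((INR (fact k) * INR (S n) ^ k) * (INR (S k) * INR (S n)))
      by (rewrite fact_simpl, mult_INR; cbn [pow]; ring).
    change (pochhammer (INR (S n)) k * (INR (S n) + INR k) <=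
      (INR (fact k) * INR (S n) ^ k) * (INR (S k) * INR (S n))).
    pose proof (pos_INR k) as hk. pose proof (pos_INR n) as hn'.
    apply Rmult_le_compat.
    + apply Rlt_le, pochhammer_pos, hn.
    + lra.
    + exact IHk.
    + rewrite !S_INR. nra.
Qed.

(* At k = 0 the identity reads 0 = n / n - 1: it fails at n = 0, so the
   induction on k only provides positive indices. *)
Lemma hyperharmonic_rec (k n : nat) :
  INR k * hyperharmonic (S k) (S n) =
  (INR (S n) + INR k) * hyperharmonic k (S n)
    - pochhammer (INR (S n)) k / INR (fact k).
Proof.
  revert n; induction k as [|k IHk].
  - intros n. pose proof (INR_S_pos n).
    change (INR 0 * hyperharmonic 1 (S n) =
      (INR (S n) + INR 0) * / INR (S n) - 1 / INR 1).
    change (INR 0) with 0. change (INR 1) with 1. field. lra.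
  - assert (all : forall n, INR (S k) * hyperharmonic (S (S k)) n =
      (INR n + INR (S k)) * hyperharmonic (S k) n
        - pochhammer (INR n) (S k) / INR (fact (S k))).
    { induction n as [|n IHn].
      (* For a positive order, n = 0 is a valid start: every term vanishes, (0)_{k+1} because its
         first factor is 0. *)
      - rewrite !hyperharmonic_0_r, pochhammer_shift. simpl (INR 0).
        unfold Rdiv. ring.
      - pose proof (INR_S_pos k) as hk. pose proof (INR_fact_neq_0 k) as hf.
        pose proof (pochhammer_diff (INR n) k) as hd.
        rewrite <- S_INR in hd.
        replace (pochhammer (INR (S n)) (S k))
          with (pochhammer (INR n) (S k)
            + INR (S k) * pochhammer (INR (S n)) k) by lra.
        rewrite (hyperharmonic_S (S k) n), Rmult_plus_distr_l, IHn.
        (* From n to n + 1 the right side grows by h_{k+1}(n+1) plus the right side of the case k at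
           n + 1, which [IHk] turns into k h_{k+1}(n+1). *)
        specialize (IHk n).
        rewrite fact_simpl, mult_INR.
        replace ((pochhammer (INR n) (S k)
            + INR (S k) * pochhammer (INR (S n)) k)
            / (INR (S k) * INR (fact k)))
          with (pochhammer (INR n) (S k) / (INR (S k) * INR (fact k))
            + pochhammer (INR (S n)) k / INR (fact k))
          by (field; split; [exact hf | lra]).
        rewrite (hyperharmonic_S k n) in IHk |- *.
        rewrite !S_INR in *. lra. }
    intros n. apply all.
Qed.

(** * Convergence of the Euler sums *)

Lemma ex_series_harmonic_sq :
  ex_series (fun n => harmonic (S n) / INR (S n) ^ 2).
Proof.
  pose (v := fun n => (harmonic (S n) + 2) / INR (S n)).
  (* With x = n + 1, the factor 2 makes the coefficient of H in the numerator x^2 - 1 >= 0; the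
     shift by 2 in [v] absorbs the increment 1/(x+1) of H and leaves 2x(x+2). *)
  assert (dom : forall n, harmonic (S n) / INR (S n) ^ 2 <= 2 * (v n - v (S n))).
  { intros n. unfold v. rewrite (harmonic_S (S n)), (S_INR (S n)).
    pose proof (harmonic_ge1 n) as hH.
    assert (hx : 1 <= INR (S n)) by (change 1 with (INR 1); apply le_INR; lia).
    set (x := INR (S n)) in *. set (H := harmonic (S n)) in *.
    apply Rminus_le.
    replace (H / x ^ 2 - 2 * ((H + 2) / x - (H + / (x + 1) + 2) / (x + 1)))
      with (- (H * (x ^ 2 - 1) + 2 * x * (x + 2)) / (x ^ 2 * (x + 1) ^ 2))
      by (field; lra).
    assert (0 < x ^ 2 * (x + 1) ^ 2)
      by (apply Rmult_lt_0_compat; apply pow_lt; lra).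
    assert (0 <= H * (x ^ 2 - 1)) by (apply Rmult_le_pos; nra).
    unfold Rdiv. rewrite Ropp_mult_distr_l_reverse.
    assert (0 <= (H * (x ^ 2 - 1) + 2 * x * (x + 2)) * / (x ^ 2 * (x + 1) ^ 2)).
    { apply Rmult_le_pos; [nra|]. apply Rlt_le, Rinv_0_lt_compat; assumption. }
    lra. }
  assert (pos : forall n, 0 <= harmonic (S n) / INR (S n) ^ 2).
  { intros n. pose proof (harmonic_ge1 n).
    apply Rmult_le_pos; [lra|].
    apply Rlt_le, Rinv_0_lt_compat, pow_lt, INR_S_pos. }
  (* By [dom] and [pos], [v] is decreasing; being nonnegative, it converges, and so does the
     telescoping series of its differences. *)
  destruct (ex_finite_lim_seq_decr v 0) as [l hl].
  { intros n. specialize (dom n). specialize (pos n). lra. }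
  { intros n. unfold v. pose proof (harmonic_ge1 n).
    apply Rmult_le_pos; [lra|]. apply Rlt_le, Rinv_0_lt_compat, INR_S_pos. }
  apply (@ex_series_le R_AbsRing R_CompleteNormedModule _
    (fun n => 2 * (v n - v (S n)))).
  { intros n. change (Rabs (harmonic (S n) / INR (S n) ^ 2) <= 2 * (v n - v (S n))).
    rewrite Rabs_pos_eq; auto. }
  apply (ex_series_scal_l 2 (fun n => v n - v (S n))).
  exists (v 0%nat - l).
  change (is_lim_seq (sum_n (fun n => v n - v (S n))) (Finite (v 0%nat - l))).
  apply (is_lim_seq_ext (fun n => v 0%nat - v (S n))).
  { induction n as [|n IHn].
    - rewrite sum_O. reflexivity.
    - rewrite sum_Sn, <- IHn. unfold plus; simpl. ring. }
  apply is_lim_seq_minus'; [apply is_lim_seq_const|].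
  apply (is_lim_seq_incr_1 v), hl.
Qed.

Lemma pow_div_le_inv_sq (j m n : nat) : (j + 2 <= m)%nat ->
  INR (S n) ^ j / INR (S n) ^ m <= / INR (S n) ^ 2.
Proof.
  intros h.
  assert (hx : 1 <= INR (S n)) by (change 1 with (INR 1); apply le_INR; lia).
  replace m with (j + (2 + (m - j - 2)))%nat by lia.
  rewrite pow_add.
  replace (INR (S n) ^ j / (INR (S n) ^ j * INR (S n) ^ (2 + (m - j - 2))))
    with (/ INR (S n) ^ (2 + (m - j - 2)))
    by (field; split; apply pow_nonzero; lra).
  apply Rinv_le_contravar; [apply pow_lt; lra|].
  apply Rle_pow; [exact hx | lia].
Qed.

(** The bound h_{k+1}(n) <= n^k H_n leaves terms of size at most H_n / n^(m-k), with m - k >= 2. *)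
Lemma ex_series_euler_term (k m : nat) : (k + 2 <= m)%nat ->
  ex_series (euler_term (S k) m).
Proof.
  intros h.
  apply (@ex_series_le R_AbsRing R_CompleteNormedModule _
    (fun n => harmonic (S n) / INR (S n) ^ 2)); [|exact ex_series_harmonic_sq].
  intros n. pose proof (pow_lt _ m (INR_S_pos n)) as hp.
  pose proof (harmonic_ge1 n) as hH.
  change (Rabs (hyperharmonic (S k) (S n) / INR (S n) ^ m)
    <= harmonic (S n) / INR (S n) ^ 2).
  rewrite Rabs_pos_eq.
  2: { apply Rmult_le_pos; [apply hyperharmonic_ge0|].
       apply Rlt_le, Rinv_0_lt_compat, hp. }
  apply Rle_trans with (harmonic (S n) * (INR (S n) ^ k / INR (S n) ^ m)).
  - unfold Rdiv. rewrite <- Rmult_assoc. apply Rmult_le_compat_r.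
    + apply Rlt_le, Rinv_0_lt_compat, hp.
    + rewrite Rmult_comm. apply hyperharmonic_le.
  - apply Rmult_le_compat_l; [lra|]. apply pow_div_le_inv_sq, h.
Qed.

(** * The hypergeometric value [B] *)

Lemma pochhammer_prod_repeat (x : R) (m : nat) (l : list R) (n : nat) :
  pochhammer_prod (repeat x m ++ l) n = pochhammer x n ^ m * pochhammer_prod l n.
Proof.
  unfold pochhammer_prod.
  induction m as [|m IHm]; simpl; [ring|]. rewrite IHm. ring.
Qed.

(** Since (1)_n = n! and (2)_n = (n+1)!, each pair of parameters 1 and 2 contributes 1/(n+1). The
    parameter k + 1 contributes (k+1)_n / n! = (n+1)_k / k!. *)
Lemma hypergeom_coeff_B (k m n : nat) :
  hypergeom_coeff (B_upper k m) (B_lower m) n =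
  pochhammer (INR (S n)) k / INR (fact k) / INR (S n) ^ m.
Proof.
  unfold hypergeom_coeff, B_upper, B_lower.
  rewrite <- (app_nil_r (repeat 2 m)), !pochhammer_prod_repeat.
  unfold pochhammer_prod; simpl fold_right.
  pose proof (pochhammer_fact 0 n) as h1.
  pose proof (pochhammer_fact 1 n) as h2.
  pose proof (pochhammer_fact k n) as h3.
  pose proof (pochhammer_fact n k) as h4.
  (* Two evaluations of (n+k)! are compared: (n+1)_k n! = (k+1)_n k!. *)
  rewrite (Nat.add_comm n k), <- h3, <- S_INR in h4.
  replace (INR 0 + 1) with 1 in h1 by (simpl; ring).
  replace (INR 1 + 1) with 2 in h2 by (simpl; ring).
  change (INR (fact 0)) with 1 in h1. change (INR (fact 1)) with 1 in h2.
  change (0 + n)%nat with n in h1. change (1 + n)%nat with (S n) in h2.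
  rewrite Rmult_1_r in h1, h2.
  pose proof (INR_S_pos n).
  pose proof (INR_fact_neq_0 n). pose proof (INR_fact_neq_0 k).
  rewrite h1, h2, fact_simpl, mult_INR, Rpow_mult_distr.
  replace (pochhammer (INR (S n)) k)
    with (pochhammer (INR k + 1) n * INR (fact k) / INR (fact n))
    by (rewrite <- h4; field; assumption).
  field. repeat split; try assumption; apply pow_nonzero; lra.
Qed.

(** The point 1 lies on the boundary of the disc of convergence, so the terms are bounded directly:
    (n)_k / (k! n^m) <= n^k / n^m <= 1/n^2 <= H_n / n^2. *)
Lemma ex_pseries_B (k m : nat) : (k + 2 <= m)%nat ->
  ex_pseries (hypergeom_coeff (B_upper k m) (B_lower m)) 1.
Proof.
  intros h.
  apply (@ex_series_le R_AbsRing R_CompleteNormedModule _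
    (fun n => harmonic (S n) / INR (S n) ^ 2)); [|exact ex_series_harmonic_sq].
  intros n. rewrite pow_n_pow, pow1, hypergeom_coeff_B.
  unfold scal, norm; simpl. unfold mult, abs; simpl. rewrite Rmult_1_l.
  change (Rabs (pochhammer (INR (S n)) k / INR (fact k) / INR (S n) ^ m)
    <= harmonic (S n) / INR (S n) ^ 2).
  pose proof (pow_lt _ m (INR_S_pos n)) as hp.
  pose proof (Rinv_0_lt_compat _ (pow_lt _ 2 (INR_S_pos n))) as h2.
  pose proof (INR_fact_lt_0 k) as hf.
  pose proof (pochhammer_pos _ k (INR_S_pos n)) as hpoch.
  rewrite Rabs_pos_eq.
  2: { apply Rlt_le. repeat apply Rdiv_lt_0_compat; assumption. }
  apply Rle_trans with (INR (S n) ^ k / INR (S n) ^ m).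
  - apply Rmult_le_compat_r; [apply Rlt_le, Rinv_0_lt_compat, hp|].
    apply Rle_div_l; [exact hf|]. rewrite Rmult_comm. apply pochhammer_le.
  - eapply Rle_trans; [apply pow_div_le_inv_sq, h|].
    pose proof (harmonic_ge1 n). unfold Rdiv.
    rewrite <- (Rmult_1_l (/ _)) at 1. apply Rmult_le_compat_r; lra.
Qed.

(** * Recurrence for the sums and telescoping *)

Lemma euler_sum_rec (k m : nat) : (k + 3 <= m)%nat ->
  euler_sum (S (S k)) m =
  euler_sum (S k) m
    + 1 / INR (S k) * (euler_sum (S k) (m - 1) - B (S k) m).
Proof.
  intros h.
  assert (ex1 : ex_series (euler_term (S k) m))
    by (apply ex_series_euler_term; lia).
  assert (ex2 : ex_series (euler_term (S k) (m - 1)))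
    by (apply ex_series_euler_term; lia).
  pose (c := hypergeom_coeff (B_upper (S k) m) (B_lower m)).
  assert (ex3 : ex_series c).
  { assert (hc : ex_pseries c 1) by (apply ex_pseries_B; lia).
    revert hc. apply ex_series_ext. intros n.
    rewrite pow_n_pow, pow1. unfold scal; simpl. unfold mult; simpl. ring. }
  assert (hB : B (S k) m = Series c).
  { unfold B, hypergeom, PSeries. apply Series_ext. intros n.
    rewrite pow1, Rmult_1_r. reflexivity. }
  rewrite hB. unfold euler_sum.
  (* [Series] is total but additive only on convergent series, hence [ex1], [ex2] and [ex3]. *)
  rewrite <- Series_minus, <- Series_scal_l, <- Series_plus; try assumption.
  2: { apply (ex_series_scal_l (1 / INR (S k))
         (fun n => euler_term (S k) (m - 1) n - c n)).
       apply (@ex_series_minus R_AbsRing R_NormedModule); assumption. }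
  apply Series_ext. intros n. unfold c. rewrite hypergeom_coeff_B.
  unfold euler_term.
  pose proof (INR_S_pos n) as hn. pose proof (INR_S_pos k) as hk.
  (* Cancelling one factor n + 1 against the coefficient of h in the recurrence produces the
     exponent m - 1. *)
  assert (hpow : INR (S n) ^ m = INR (S n) * INR (S n) ^ (m - 1))
    by (rewrite tech_pow_Rmult; f_equal; lia).
  rewrite hpow.
  pose proof (hyperharmonic_rec (S k) n) as hrec.
  replace (hyperharmonic (S (S k)) (S n))
    with (((INR (S n) + INR (S k)) * hyperharmonic (S k) (S n)
      - pochhammer (INR (S n)) (S k) / INR (fact (S k))) / INR (S k))
    by (rewrite <- hrec; field; lra).
  pose proof (pow_lt _ (m - 1) hn). pose proof (INR_fact_lt_0 (S k)).
  field. repeat split; lra.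
Qed.

(** Convergence is asserted along with the equality, because [Series] and [PSeries] give a real
    value even to divergent series. *)
Theorem theorem4 (r m : nat) (hr : (2 <= r)%nat) (hm : (r + 1 <= m)%nat) :
  ex_series (euler_term r m) /\
  ex_series (euler_term 1 m) /\
  (forall k : nat, (1 <= k <= r - 1)%nat ->
     ex_series (euler_term k (m - 1)) /\
     ex_pseries (hypergeom_coeff (B_upper k m) (B_lower m)) 1) /\
  euler_sum r m =
    euler_sum 1 m +
    sum_n_m (fun k : nat => 1 / INR k * (euler_sum k (m - 1) - B k m)) 1 (r - 1).
Proof.
  destruct r as [|r]; [lia|].
  split; [apply ex_series_euler_term; lia|].
  split; [apply ex_series_euler_term; lia|].
  split.
  - intros [|k] hk; [lia|].
    split; [apply ex_series_euler_term | apply ex_pseries_B]; lia.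
  (* Without [hr] the induction can start at order 1, where the sum over k is empty. *)
  - replace (S r - 1)%nat with r by lia. clear hr.
    induction r as [|r IHr].
    + rewrite sum_n_m_zero by lia. unfold zero; simpl. ring.
    + rewrite euler_sum_rec, IHr, sum_n_Sm by lia. unfold plus; simpl. ring.
Qed.
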